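(* Let $\pi_1:\mathbb{Q}\langle e_0,e_1\rangle\to\mathbb{Q}e_0\oplus\mathbb{Q}e_1$ be the projection onto weight $1$, and $\Delta:\mathbb{Q}\langle e_0,e_1\rangle\to\mathbb{Q}\langle e_0,e_1\rangle\otimes\mathbb{Q}\langle e_0,e_1\rangle$ the algebra homomorphism with $\Delta(e_i)=e_i\otimes1+1\otimes e_i$. Then $\Delta_1:=(\pi_1\otimes\mathrm{id})\Delta$ satisfies, for every $n\ge1$, $$\Delta_1\mathcal B^n\subset\mathcal B^1\otimes\mathcal B^{n-1}.$$
   Context: $\mathbb{Q}\langle e_0,e_1\rangle$ is the free associative $\mathbb{Q}$-algebra on $e_0,e_1$; the weight of a word is its length. For a word $v=a_1\cdots a_N$ its block degree is $\deg_{\mathcal B}(v)=\#\{i:1\le i<N,\ a_i=a_{i+1}\}$. $\mathcal B^n=\mathcal B^n\mathbb{Q}\langle e_0,e_1\rangle$ is the span of words $w$ with $\deg_{\mathcal B}(e_0we_1)\ge n$ (with $\mathcal B^0=\mathbb{Q}\langle e_0,e_1\rangle$). *)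

(* Defs.v *)
From HB Require Import structures.
From mathcomp Require Import all_boot all_order all_algebra.
From mathcomp Require Import finmap.
From mathcomp Require Import xfinmap monalg.

Set Implicit Arguments.
Unset Strict Implicit.
Unset Printing Implicit Defensive.

Import GRing.Theory.
Local Open Scope ring_scope.

Section ProductMonoid.
Variables M N : monomType.
Implicit Types x y z : M * N.

Let pone : M * N := (mone, mone).
Let pmul x y : M * N := (mmul x.1 y.1, mmul x.2 y.2).

Fact pmulA : associative pmul.
Proof. by move=> x y z; rewrite /pmul /= !mulmA. Qed.
Fact pmul1m : left_id pone pmul.
Proof. by case=> x y; rewrite /pmul /= !mul1m. Qed.
Fact pmulm1 : right_id pone pmul.
Proof. by case=> x y; rewrite /pmul /= !mulm1. Qed.
Fact punitm x y : pmul x y = pone -> x = pone /\ y = pone.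
Proof. by case: x y => [a b] [c d] [] /unitm[-> ->] /unitm[-> ->]. Qed.

HB.instance Definition _ :=
  Choice_isMonomialDef.Build (M * N)%type pmulA pmul1m pmulm1 punitm.
End ProductMonoid.

HB.lock Definition linext (K : choiceType) (V : lmodType rat) (h : K -> V)
    (g : {malg rat[K]}) : V :=
  \sum_(k <- msupp g) g@_k *: h k.

Section LinearExtension.
Variables (K : choiceType) (V : lmodType rat).
Variable h : K -> V.

Lemma linextEw (d : {fset K}) g : (msupp g `<=` d)%fset ->
  linext h g = \sum_(k <- d) g@_k *: h k.
Proof.
move=> le; rewrite linext.unlock; apply: big_fset_incl => // x _ /mcoeff_outdom ->.
by rewrite scale0r.
Qed.

Fact linext_is_linear : linear (linext h).
Proof.
move=> a u v; set d := (msupp u `|` msupp v)%fset.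
rewrite (@linextEw d u) ?fsubsetUl // (@linextEw d v) ?fsubsetUr //.
rewrite (@linextEw d); last first.
  apply/fsubsetP=> k /(fsubsetP (msuppD_le _ _)); rewrite !in_fsetU.
  by case/orP=> [/(fsubsetP (msuppZ_le _ _))|] ->; rewrite ?orbT.
rewrite scaler_sumr -big_split /=; apply: eq_bigr => k _.
by rewrite mcoeffD mcoeffZ scalerDl scalerA.
Qed.

HB.instance Definition _ :=
  GRing.isLinear.Build rat {malg rat[K]} V *:%R (linext h) linext_is_linear.

Lemma linextU k : linext h << k >> = h k.
Proof. by rewrite (linextEw (msuppU_le)) big_seq_fset1 mcoeffUU scale1r. Qed.

Lemma linext_uniq (f : {linear {malg rat[K]} -> V}) :
  (forall k, f << k >> = h k) -> f =1 linext h.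
Proof.
move=> fE g; rewrite {1}[g]monalgE linear_sum linext.unlock; apply: eq_bigr => k _ /=.
rewrite -fE -linearZ; congr (f _); apply/malgP => l.
by rewrite mcoeffZ !mcoeffU mulrnAr mulr1.
Qed.
End LinearExtension.

Section Span.
Variable V : lmodType rat.

Definition span (P : V -> Prop) (v : V) : Prop :=
  exists s : seq (rat * V),
    (forall x, x \in s -> P x.2) /\ v = \sum_(x <- s) x.1 *: x.2.
End Span.

(* Words in e_0, e_1: the letters e_0 and e_1 are false and true. *)
Notation word := {fmonom bool}.
Notation QA := {malg rat[word]}.
Notation e i := (@mkmalgU word rat (fmu i) 1).

(* The tensor square, as the monoid algebra of the product of two copies of the
   monoid of words: the basis vector << (v, w) >> is v (x) w. See [tens_lift_ex]
   and [tens_lift_uniq] for the universal property, and [tensM] for the product. *)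
Notation QAA := {malg rat[(word * word)%type]}.

Definition tens (u v : QA) : QAA :=
  linext (fun k => linext (fun l => << (k, l) >> : QAA) v) u.
Notation "u ⊗ v" := (tens u v) (at level 40, left associativity) : ring_scope.

Lemma tensUU (k l : word) : << k >> ⊗ << l >> = << (k, l) >>.
Proof. by rewrite /tens !linextU. Qed.

Fact tens_linearl v : linear (tens^~ v).
Proof. by move=> a u1 u2; rewrite /tens linearP. Qed.

Fact tens_linearr u : linear (tens u).
Proof.
move=> a v1 v2; rewrite /tens !(linextEw _ (fsubset_refl (msupp u))).
rewrite scaler_sumr -big_split /=; apply: eq_bigr => k _.
by rewrite linearP scalerDr !scalerA mulrC.
Qed.

HB.instance Definition _ u :=
  GRing.isLinear.Build rat QA QAA *:%R (tens u) (tens_linearr u).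

Definition tens_lift (V : lmodType rat) (b : QA -> QA -> V) : QAA -> V :=
  linext (fun kl : (word * word)%type => b << kl.1 >> << kl.2 >>).
Fact tens_liftP (V : lmodType rat) (b : QA -> QA -> V) : linear (tens_lift b).
Proof. by rewrite /tens_lift; apply: linext_is_linear. Qed.
HB.instance Definition _ (V : lmodType rat) (b : QA -> QA -> V) :=
  GRing.Linear.on (tens_lift b).

Lemma malgU_scale (K : choiceType) (c : rat) (k : K) :
  << c *g k >> = c *: << k >> :> {malg rat[K]}.
Proof. by apply/malgP => l; rewrite mcoeffZ !mcoeffU mulrnAr mulr1. Qed.

Lemma malg_ind (K : choiceType) (P : {malg rat[K]} -> Prop) :
  P 0 -> (forall c k u, P u -> P (c *: << k >> + u)) -> forall u, P u.
Proof.
move=> P0 PD u; rewrite [u]monalgE.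
by elim/big_rec: _ => // k v _ Pv; rewrite malgU_scale; apply: PD.
Qed.

Lemma tens0l v : 0 ⊗ v = 0.
Proof. by rewrite /tens linear0. Qed.

Lemma tens_lift_ex (V : lmodType rat) (b : QA -> QA -> V) :
  (forall v, linear (b^~ v)) -> (forall u, linear (b u)) ->
  forall u v, tens_lift b (u ⊗ v) = b u v.
Proof.
move=> bl br u v.
have b0l w : b 0 w = 0.
  by have := bl w (-1) 0 0; rewrite scaler0 addr0 scaleN1r addNr.
have b0r w : b w 0 = 0.
  by have := br w (-1) 0 0; rewrite scaler0 addr0 scaleN1r addNr.
elim/malg_ind: u => [|c k u IHu]; first by rewrite tens0l linear0 b0l.
rewrite tens_linearl tens_liftP IHu (bl v); congr (_ *: _ + _).
elim/malg_ind: v {IHu} => [|d l v IHv]; first by rewrite !linear0 b0r.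
by rewrite tens_linearr tens_liftP br IHv tensUU /tens_lift linextU.
Qed.

Lemma tens_lift_uniq (V : lmodType rat) (f g : {linear QAA -> V}) :
  (forall u v, f (u ⊗ v) = g (u ⊗ v)) -> f =1 g.
Proof.
move=> fg; elim/malg_ind => [|c [k l] u IHu]; first by rewrite !linear0.
by rewrite !linearP IHu -tensUU fg.
Qed.

Lemma malgUM (M : monomType) (k l : M) :
  << k >> * << l >> = << mmul k l >> :> {malg rat[M]}.
Proof. by rewrite malgM_def fgmulUU mulr1. Qed.

Lemma malg_scaleAr (M : monomType) (c : rat) (u v : {malg rat[M]}) :
  c *: (u * v) = u * (c *: v).
Proof.
elim/malg_ind: u => [|d k u IHu]; first by rewrite !mul0r scaler0.
rewrite !mulrDl scalerDr IHu -!scalerAl; congr (_ + _).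
rewrite scalerA mulrC -scalerA; congr (_ *: _).
elim/malg_ind: v {u IHu} => [|a l v IHv]; first by rewrite mulr0 !scaler0 mulr0.
rewrite mulrDr !scalerDr mulrDr IHv; congr (_ + _).
have ZU (x y : rat) m : x *: << y *g m >> = << x * y *g m >> :> {malg rat[M]}.
  by rewrite malgU_scale scalerA -malgU_scale.
by rewrite -malgU_scale ZU !malgM_def !fgmulUU ZU !mul1r.
Qed.

Lemma malg_mulPl (M : monomType) (c : rat) (x y z : {malg rat[M]}) :
  (c *: x + y) * z = c *: (x * z) + y * z.
Proof. by rewrite mulrDl -scalerAl. Qed.

Lemma malg_mulPr (M : monomType) (c : rat) (x y z : {malg rat[M]}) :
  z * (c *: x + y) = c *: (z * x) + z * y.
Proof. by rewrite mulrDr -malg_scaleAr. Qed.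

Lemma tensPl c u1 u2 v : (c *: u1 + u2) ⊗ v = c *: (u1 ⊗ v) + u2 ⊗ v.
Proof. exact: tens_linearl. Qed.

Lemma tensPr c u v1 v2 : u ⊗ (c *: v1 + v2) = c *: (u ⊗ v1) + u ⊗ v2.
Proof. exact: tens_linearr. Qed.

Lemma tens0r u : u ⊗ 0 = 0.
Proof. exact: linear0. Qed.

Lemma malg_congP (K : choiceType) (c : rat) (x y z t : {malg rat[K]}) :
  x = y -> z = t -> c *: x + z = c *: y + t.
Proof. by move=> -> ->. Qed.

Lemma tensM u1 u2 v1 v2 : (u1 ⊗ v1) * (u2 ⊗ v2) = (u1 * u2) ⊗ (v1 * v2).
Proof.
elim/malg_ind: u1 => [|a k u1 IH]; first by rewrite tens0l !mul0r tens0l.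
rewrite (tensPl a) (malg_mulPl a) IH (malg_mulPl a) (tensPl a).
apply: malg_congP; last by [].
elim/malg_ind: v1 {IH} => [|b l v1 IH].
  by rewrite tens0r mul0r mul0r tens0r.
rewrite (tensPr b) (malg_mulPl b) IH (malg_mulPl b) (tensPr b).
apply: malg_congP; last by [].
elim/malg_ind: u2 {IH} => [|c m u2 IH].
  by rewrite tens0l mulr0 mulr0 tens0l.
rewrite (tensPl c) (malg_mulPr c) IH (malg_mulPr c) (tensPl c).
apply: malg_congP; last by [].
elim/malg_ind: v2 {IH} => [|d n v2 IH].
  by rewrite tens0r mulr0 mulr0 tens0r.
rewrite (tensPr d) (malg_mulPr d) IH (malg_mulPr d) (tensPr d).
apply: malg_congP; last by [].
by rewrite !tensUU !malgUM tensUU.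
Qed.

Definition tens_map (f g : QA -> QA) : QAA -> QAA :=
  tens_lift (fun u v => f u ⊗ g v).

Lemma tens_mapE (f g : {linear QA -> QA}) u v :
  tens_map f g (u ⊗ v) = f u ⊗ g v.
Proof.
rewrite /tens_map tens_lift_ex // => [w|w] a x y.
  by rewrite linearP tens_linearl.
by rewrite !linearP.
Qed.

(* The image of U (x) V in QAA; the map is injective, over a field. *)
Definition tens_sub (U V : QA -> Prop) : QAA -> Prop :=
  span (fun t => exists u v, [/\ U u, V v & t = u ⊗ v]).

(* The codomain Q e_0 + Q e_1 is viewed inside QA, see [pi1E]. *)
Definition pi1 : QA -> QA :=
  linext (fun w : word => if fdeg w == 1%N then << w >> else 0).
Fact pi1P : linear pi1.
Proof. by rewrite /pi1; apply: linext_is_linear. Qed.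
HB.instance Definition _ := GRing.Linear.on pi1.

Lemma pi1E u : pi1 u = u@_(fmu false) *: e false + u@_(fmu true) *: e true.
Proof.
elim/malg_ind: u => [|c w u IHu]; first by rewrite linear0 !mcoeff0 !scale0r addr0.
rewrite pi1P IHu /pi1 linextU !mcoeffD !mcoeffZ !mcoeffU1 !scalerDl addrACA.
congr (_ + _); rewrite -!scalerA -scalerDr; congr (_ *: _).
rewrite /fdeg; case: w => -[|i [|j s]]; rewrite !fmuE -!val_eqE /=.
- by rewrite !scale0r addr0.
- by case: i; rewrite /= ?eqxx scale1r scale0r ?addr0 ?add0r.
- by rewrite !eqseq_cons !andbF !scale0r addr0.
Qed.

(* The extension of the given values on letters to words by multiplicativity,
   then to QA by linearity; see [Delta_e] and [Delta_uniq]. *)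
Definition Delta : QA -> QAA :=
  linext (fun w : word => \prod_(i <- w) (e i ⊗ 1 + 1 ⊗ e i)).
Fact DeltaP : linear Delta.
Proof. by rewrite /Delta; apply: linext_is_linear. Qed.
HB.instance Definition _ := GRing.Linear.on Delta.

Lemma DeltaU w : Delta << w >> = \prod_(i <- w) (e i ⊗ 1 + 1 ⊗ e i).
Proof. by rewrite /Delta linextU. Qed.

Fact Delta_is_monoid_morphism : monoid_morphism Delta.
Proof.
split=> [|u v]; first by rewrite DeltaU fm1 big_nil.
have DP c x y : Delta (c *: x + y) = c *: Delta x + Delta y by apply: DeltaP.
elim/malg_ind: u => [|c k u IHu]; first by rewrite mul0r linear0 mul0r.
rewrite (malg_mulPl c); apply: etrans (DP _ _ _) _.
rewrite (DP c << k >> u) (malg_mulPl c); apply: malg_congP IHu.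
elim/malg_ind: v => [|d l v IHv]; first by rewrite mulr0 linear0 mulr0.
rewrite (malg_mulPr d); apply: etrans (DP _ _ _) _.
rewrite (DP d << l >> v) (malg_mulPr d); apply: malg_congP IHv.
by rewrite malgUM (DeltaU (mmul k l)) (DeltaU k) (DeltaU l) fmM big_cat.
Qed.

HB.instance Definition _ :=
  GRing.isMonoidMorphism.Build QA QAA Delta Delta_is_monoid_morphism.

Lemma Delta_e i : Delta (e i) = e i ⊗ 1 + 1 ⊗ e i.
Proof. by rewrite DeltaU fmU big_seq1. Qed.

Lemma Delta_uniq (D : {lrmorphism QA -> QAA}) :
  (forall i, D (e i) = e i ⊗ 1 + 1 ⊗ e i) -> D =1 Delta.
Proof.
move=> De; apply: linext_uniq => -[w]; elim: w => [|i w IHw].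
  by rewrite big_nil -fmoneE rmorph1.
have -> : FMonom (i :: w) = mmul (fmu i) (FMonom w).
  by apply: val_inj; rewrite /= fmM fmU.
by rewrite -malgUM rmorphM /= De IHw fmM fmU big_cat big_seq1.
Qed.

Definition Delta1 (u : QA) : QAA := tens_map pi1 idfun (Delta u).

Definition blockdeg (v : seq bool) : nat :=
  #|[set i : 'I_(size v).-1 | nth false v i == nth false v i.+1]|.

Definition B (n : nat) : QA -> Prop :=
  span (fun u => exists w : word,
    (n <= blockdeg (mmul (mmul (fmu false) w) (fmu true)))%N /\ u = << w >>).

(* Main.v *)
Require Import Defs.
From HB Require Import structures.
From mathcomp Require Import all_boot all_order all_algebra.
From mathcomp Require Import xfinmap monalg.

Set Implicit Arguments.
Unset Strict Implicit.
Unset Printing Implicit Defensive.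

(** Delta_1 sends a_1 ... a_N to the sum over i of
    a_i (x) a_1 ... a_(i-1) a_(i+1) ... a_N, and deleting one letter lowers the
    block degree by at most one.  The left factors are letters, which lie in B^1
    since e_0 e_i e_1 always has a repetition. *)

Import GRing.Theory.
Local Open Scope ring_scope.

(* [span] alone would denote the span of a sequence in a [vectType]. *)
Local Notation span := Defs.span.

Lemma span0 (V : lmodType rat) (P : V -> Prop) : span P 0.
Proof. by exists [::]; rewrite big_nil. Qed.

Lemma spanD (V : lmodType rat) (P : V -> Prop) (u v : V) :
  span P u -> span P v -> span P (u + v).
Proof.
case=> s [sP ->] [t [tP ->]]; exists (s ++ t); rewrite big_cat; split=> // x.
by rewrite mem_cat => /orP[/sP|/tP].
Qed.

Lemma spanZ (V : lmodType rat) (P : V -> Prop) (c : rat) (u : V) :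
  span P u -> span P (c *: u).
Proof.
case=> s [sP ->]; exists [seq (c * x.1, x.2) | x <- s].
split=> [x /mapP[y /sP ? ->] //|].
by rewrite big_map scaler_sumr; apply: eq_bigr => x _; rewrite scalerA.
Qed.

Lemma mem_span (V : lmodType rat) (P : V -> Prop) (u : V) : P u -> span P u.
Proof.
move=> Pu; exists [:: (1, u)]; rewrite big_seq1 scale1r; split=> // x.
by rewrite inE => /eqP ->.
Qed.

Lemma span_linear (V W : lmodType rat) (P : V -> Prop) (Q : W -> Prop)
    (f : {linear V -> W}) :
  (forall u, P u -> span Q (f u)) -> forall u, span P u -> span Q (f u).
Proof.
move=> fP u [s [sP ->]]; rewrite linear_sum.
elim: s sP => [|x s IHs] sP; first by rewrite big_nil; apply: span0.
rewrite big_cons; apply: spanD.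
  by rewrite linearZ; apply/spanZ/fP/sP/mem_head.
by apply: IHs => y ys; apply: sP; rewrite inE ys orbT.
Qed.

(** Linearity is assumed of plain functions, so that composites such as [counitl] after [Delta] can
    be compared on words without being bundled. *)
Lemma linear_malg_ext (K : choiceType) (V : lmodType rat)
    (f g : {malg rat[K]} -> V) :
  linear f -> linear g -> (forall k, f << k >> = g << k >>) -> f =1 g.
Proof.
have linear_at0 h : linear h -> h 0 = 0 :> V.
  by move=> hL; have := hL (-1) 0 0; rewrite scaler0 addr0 scaleN1r addNr.
move=> fL gL fg; elim/malg_ind => [|c k u IHu]; first by rewrite !linear_at0.
by rewrite fL gL fg IHu.
Qed.

Lemma linear_funcomp (U V W : lmodType rat) (f : V -> W) (g : U -> V) :
  linear f -> linear g -> linear (fun u => f (g u)).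
Proof. by move=> fL gL c u v; rewrite gL fL. Qed.

Lemma malg_mulr_linear (M : monomType) (x : {malg rat[M]}) :
  linear (fun y => x * y).
Proof. by move=> c y z; apply: malg_mulPr. Qed.

Lemma blockdeg_cons2 (x y : bool) (s : seq bool) :
  blockdeg [:: x, y & s] = ((x == y) + blockdeg (y :: s))%N.
Proof.
rewrite /blockdeg !cardsE -!sum1_card big_mkcond big_ord_recl /=.
by rewrite [in RHS]big_mkcond; congr (_ + _)%N; case: (x == y).
Qed.

(** Between neighbours [x] and [y], the two pairs [x a] and [a y] give way to the single pair [x y];
    if both were repetitions, then [x = a = y] and the new pair is one too. At an end of the word
    only one pair disappears. *)
Lemma blockdeg_delete (s t : seq bool) (a : bool) :
  (blockdeg (s ++ a :: t) <= (blockdeg (s ++ t)).+1)%N.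
Proof.
(* If at least two letters precede [a], the first pair survives the deletion and induction applies;
   prefixes of length 0 and 1 remain. *)
elim: s => [|x [|y s] IHs] /=; last by rewrite !blockdeg_cons2 -addnS leq_add2l.
- case: t => [|y t]; last by rewrite blockdeg_cons2 -add1n leq_add2r leq_b1.
  by rewrite [leqLHS](_ : _ = 0)%N // /blockdeg cardsE eq_card0 // => -[].
- case: t {IHs} => [|y t]; rewrite !blockdeg_cons2.
    have -> : blockdeg [:: a] = 0%N by rewrite /blockdeg cardsE eq_card0 // => -[].
    by case: (x == a).
  by rewrite addnA -addSn leq_add2r; move: x a y => [] [] [].
Qed.

Lemma B_letter (i : bool) : B 1 (e i).
Proof.
apply: mem_span; exists (fmu i); split=> //.
by rewrite !fmM !fmU /= !blockdeg_cons2; case: i.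
Qed.

(** The map ε ⊗ id, where the counit ε takes the coefficient of the empty word. *)
Definition counitl : QAA -> QA := tens_lift (fun u v => u@_mone *: v).

Fact counitlP : linear counitl.
Proof. exact: tens_liftP. Qed.

HB.instance Definition _ :=
  GRing.isLinear.Build rat QAA QA *:%R counitl counitlP.

Lemma counitlU (k l : word) : counitl << (k, l) >> = (k == mone)%:R *: << l >>.
Proof. by rewrite /counitl /tens_lift linextU /= mcoeffU1 eq_sym. Qed.

(** The summand [e i ⊗ 1] makes every left word nonempty, so the counit kills it; the other summand
    acts on right factors alone. *)
Lemma counitl_letter (i : bool) (t : QAA) :
  counitl ((e i ⊗ 1 + 1 ⊗ e i) * t) = e i * counitl t.
Proof.
move: t; apply: linear_malg_ext => [||[k l]].
- exact: linear_funcomp counitlP (malg_mulr_linear _).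
- exact: linear_funcomp (malg_mulr_linear _) counitlP.
rewrite mulrDl -(tensUU k l) !tensM !mul1r !malgUM !tensUU linearD /= !counitlU.
rewrite -malg_scaleAr malgUM.
suff -> : (mmul (fmu i) k == mone) = false by rewrite scale0r add0r.
by apply/eqP => /(congr1 (@fdeg _)); rewrite fdegM fdegU fdeg1.
Qed.

Lemma word_cons (i : bool) (s : seq bool) :
  << FMonom (i :: s) >> = e i * << FMonom s >> :> QA.
Proof. by rewrite malgUM; congr << _ >>; apply: val_inj; rewrite /= fmM fmU. Qed.

Lemma Delta_letterM (i : bool) (u : QA) :
  Delta (e i * u) = (e i ⊗ 1 + 1 ⊗ e i) * Delta u.
Proof. by have [_ ->] := Delta_is_monoid_morphism; rewrite Delta_e. Qed.

Lemma Delta_nil : Delta << FMonom [::] >> = << mone >> ⊗ << mone >>.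
Proof. by rewrite DeltaU big_nil tensUU. Qed.

(** The counit axiom, by peeling off letters. It shows that a letter selected on the left leaves the
    rest of the word intact on the right. *)
Lemma counitl_Delta (u : QA) : counitl (Delta u) = u.
Proof.
move: u; apply: linear_malg_ext => [|//|[s]].
  exact: linear_funcomp counitlP DeltaP.
elim: s => [|i s IHs]; last by rewrite word_cons Delta_letterM counitl_letter IHs.
by rewrite Delta_nil tensUU counitlU eqxx scale1r -fmoneE.
Qed.

Lemma tens_map_linear (f g : QA -> QA) : linear (tens_map f g).
Proof. exact: tens_liftP. Qed.

HB.instance Definition _ (f g : QA -> QA) :=
  GRing.isLinear.Build rat QAA QAA *:%R (tens_map f g) (tens_map_linear f g).

Fact Delta1_is_linear : linear Delta1.
Proof. exact: linear_funcomp (tens_map_linear _ _) DeltaP. Qed.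

HB.instance Definition _ :=
  GRing.isLinear.Build rat QA QAA *:%R Delta1 Delta1_is_linear.

Lemma tens_map_pi1U (k l : word) :
  tens_map pi1 idfun << (k, l) >> = pi1 << k >> ⊗ << l >>.
Proof. by rewrite -tensUU tens_mapE. Qed.

(** A left word beginning with [i] has weight one exactly when nothing follows, so only the terms of
    [t] with empty left word survive; [counitl] extracts them. *)
Lemma tens_map_pi1_letterl (i : bool) (t : QAA) :
  tens_map pi1 idfun ((e i ⊗ 1) * t) = e i ⊗ counitl t.
Proof.
move: t; apply: linear_malg_ext => [||[k l]].
- exact: linear_funcomp (tens_map_linear _ _) (malg_mulr_linear _).
- exact: linear_funcomp (tens_linearr _) counitlP.
rewrite -(tensUU k l) tensM mul1r malgUM !tensUU tens_map_pi1U counitlU.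
rewrite /pi1 linextU fdegM fdegU add1n eqSS fdeg_eq0.
by case: eqP => [->|_]; rewrite ?mulm1 ?scale1r // scale0r tens0l tens0r.
Qed.

Lemma tens_map_pi1_letterr (i : bool) (t : QAA) :
  tens_map pi1 idfun ((1 ⊗ e i) * t) = (1 ⊗ e i) * tens_map pi1 idfun t.
Proof.
move: t; apply: linear_malg_ext => [||[k l]].
- exact: linear_funcomp (tens_map_linear _ _) (malg_mulr_linear _).
- exact: linear_funcomp (malg_mulr_linear _) (tens_map_linear _ _).
rewrite tens_map_pi1U -(tensUU k l) !tensM !mul1r malgUM tensUU.
exact: tens_map_pi1U.
Qed.

(** The letter selected on the left is either the first one, which leaves all of [u] on the right,
    or a later one, and then [e i] stays in front on the right. *)
Lemma Delta1_letter (i : bool) (u : QA) :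
  Delta1 (e i * u) = e i ⊗ u + (1 ⊗ e i) * Delta1 u.
Proof.
rewrite /Delta1 Delta_letterM mulrDl; apply: etrans (linearD _ _ _) _; congr (_ + _).
  by rewrite /= tens_map_pi1_letterl counitl_Delta.
exact: tens_map_pi1_letterr.
Qed.

(* The prefix [p] makes the statement stable under peeling letters off [s]. *)
Lemma Delta1_word (n : nat) (p : word) (s : seq bool) :
  (n <= blockdeg (false :: p ++ s ++ [:: true]))%N ->
  tens_sub (B 1) (B (n - 1)) ((1 ⊗ << p >>) * Delta1 << FMonom s >>).
Proof.
elim: s p => [|i s IHs] p n_le.
  (* The empty word has no letter to select: its left factor has weight 0, which [pi1] kills. *)
  rewrite /Delta1 Delta_nil (tensUU mone mone) tens_map_pi1U.
  by rewrite /pi1 linextU fdeg1 tens0l mulr0; apply: span0.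
rewrite word_cons Delta1_letter mulrDr mulrA !tensM !mul1r !malgUM.
apply: spanD.
  apply: mem_span; exists (e i), << mmul p (FMonom s) >>; split=> //.
    exact: B_letter.
  apply: mem_span; exists (mmul p (FMonom s)); split=> //.
  (* Moving the subtracted 1 to the other side gives exactly the loss allowed when [i] is deleted
     after [false :: p]. *)
  rewrite !fmM !fmU leq_subLR add1n (leq_trans n_le) //= -catA.
  exact: (blockdeg_delete (false :: p)).
(* The letter kept on the right joins the prefix, so the full word and its bound are unchanged. *)
by apply: IHs; rewrite fmM fmU -catA.
Qed.

Lemma Delta1_B (n : nat) (u : QA) : B n u ->
  tens_sub (B 1) (B (n - 1)) (Delta1 u).
Proof.
apply: span_linear => _ [[s] [n_le ->]]; rewrite !fmM !fmU in n_le.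
(* With the empty prefix the outer factor is [1 ⊗ 1], the unit. *)
have := @Delta1_word n mone s; rewrite (tensUU mone mone) mul1r fm1; exact.
Qed.

Local Close Scope ring_scope.

Theorem theorem6p1 (n : nat) (hn : 1 <= n) (u : QA) (hu : B n u) :
  tens_sub (B 1) (B (n - 1)) (Delta1 u).
Proof.
exact: Delta1_B.
Qed.
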